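(* For every positive integer $k$ there is a constant $\gamma_k$ such that every strongly connected digraph $D$ with $\chi(D)>\gamma_k$ contains a subdivision of $B(k,1;k)$.
   Context: Digraphs are finite, without loops or parallel arcs (opposite arcs allowed). $\chi(D)$ is the chromatic number of the underlying undirected graph of $D$. A digraph is strongly connected if every vertex can reach every other vertex by a directed path. For positive integers $k_1,k_2,k_3$, a digraph $D$ contains a subdivision of $B(k_1,k_2;k_3)$ if there exist distinct vertices $x,y$ of $D$ and three pairwise internally vertex-disjoint directed paths in $D$: two from $x$ to $y$, of lengths (numbers of arcs) at least $k_1$ and at least $k_2$ respectively, and one from $y$ to $x$ of length at least $k_3$. *)

(* Defs.v *)
From mathcomp Require Import all_boot.
Set Implicit Arguments. Unset Strict Implicit. Unset Printing Implicit Defensive.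

(* A digraph on a finite vertex type V is an arc relation a : rel V.
   A relation has no parallel arcs; loops are excluded by [irreflexive a];
   opposite arcs (a x y and a y x) are allowed. *)

Section Digraph.
Variables (V : finType) (a : rel V).

Definition loopless : Prop := irreflexive a.

Definition proper_coloring (c : nat) (f : {ffun V -> 'I_c}) : bool :=
  [forall x, forall y, (a x y || a y x) ==> (f x != f y)].

Definition colorable (c : nat) : bool :=
  [exists f : {ffun V -> 'I_c}, proper_coloring f].

(* chi(D): the least c such that the underlying graph is c-colourable.
   For a loopless digraph, c = #|V| always works, so the least such c lies
   in [0, #|V|] and is found by [find] below. *)
Definition chi : nat := find colorable (iota 0 #|V|.+1).

Definition strongly_connected : Prop := forall x y : V, connect a x y.

Definition dipath (x y : V) (p : seq V) : bool :=
  [&& path a x p, last x p == y & uniq (x :: p)].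

(* internal vertices of the path x :: p (p nonempty): p without its last vertex *)
Definition interior (p : seq V) : seq V := take (size p).-1 p.

Definition int_disjoint (p q : seq V) : bool :=
  all (fun v => v \notin interior q) (interior p).

Definition contains_B (k1 k2 k3 : nat) : Prop :=
  exists (x y : V) (p1 p2 p3 : seq V),
    [/\ x != y,
        [/\ dipath x y p1, dipath x y p2 & dipath y x p3],
        [/\ k1 <= size p1, k2 <= size p2 & k3 <= size p3],
        p1 != p2 &
        [/\ int_disjoint p1 p2, int_disjoint p1 p3 & int_disjoint p2 p3]].

End Digraph.

(* Main.v *)
Require Import Defs.
From Stdlib Require Import Classical.
From mathcomp Require Import all_boot zify.
Set Implicit Arguments. Unset Strict Implicit. Unset Printing Implicit Defensive.

(* Suppose D contains no subdivision of B(k,1;k) (with k > 1) and let S be a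
   strongly connected set of vertices, b(x) the distance from x to S.  A petal
   of S is a cycle that leaves S by one arc s -> w and comes back along a
   shortest path from w to S; let X be the union of the petals outside S.
   - Colour X first by b when b < k and by b modulo k when b >= k.  Inside a
     colour class b does not decrease along arcs, and two distinct values of b
     are at least k and differ by at least k.  Hence a path in a class meets a
     petal at most once: two consecutive meeting points would be the ends of an
     ear which, with the petal, is a subdivision of B(k,1;k).
   - So along the petals, one can go from the last vertex of such a path to any
     other one through S, off the path.  If the path has 2k+1 vertices, going
     to its first vertex closes a cycle, and going to its middle vertex provides
     an ear of that cycle whose ends are at distance at least k both ways.
   By the Gallai-Roy theorem each class is thus 2k-colourable and X is
   4k^2-colourable.  Adding to S the petals of D and those of the reverse of D
   gives a larger strongly connected set containing all neighbours of S;
   iterating from one vertex yields layers, each 8k^2-colourable, with arcs only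
   inside a layer or between consecutive layers, so chi(D) <= 16k^2. *)

(** * The Gallai-Roy theorem, by rooted spanning forests *)

Section GallaiRoy.
Variables (V : finType) (e : rel V) (n : nat).
Hypothesis e_irr : irreflexive e.
Hypothesis short_paths : forall x p, path e x p -> uniq (x :: p) -> size p < n.

Definition leveled_forest (par : V -> V) (l : V -> nat) : Prop :=
  forall w, if par w == w then l w = 0 else e (par w) w /\ l w = (l (par w)).+1.

Lemma level_ancestor par l x y :
  leveled_forest par l -> fconnect par x y -> (l y < l x) || (x == y).
Proof.
move=> F /connectP [p]; elim: p x => [|z p IHp] x /=; first by move=> _ ->; rewrite eqxx orbT.
move=> /andP [/eqP <- pP] yE; have := IHp _ pP yE.
have := F x; case: eqP => [-> //|_ [_ ->]].
by case/orP => [|/eqP <-]; rewrite ?ltnSn // => /ltnW; rewrite ltnS => ->.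
Qed.

(** The path is the branch from a root down to [v]; the bound on the levels is carried along because
    it yields [uniq] in the induction. *)
Lemma level_path par l v : leveled_forest par l ->
  exists x p, [/\ path e x p, last x p = v, size p = l v, uniq (x :: p) &
                  all (fun w => l w <= l v) (x :: p)].
Proof.
move=> F; move En: (l v) => m; elim: m v En => [|m IHm] v En.
  by exists v, [::]; rewrite /= En.
have := F v; case: eqP => [_|_ [ev]]; first by rewrite En.
rewrite En => -[/esym lE]; have [x [p [pP lastp sz up ap]]] := IHm _ lE.
exists x, (rcons p v); split.
- by rewrite rcons_path pP lastp.
- by rewrite last_rcons.
- by rewrite size_rcons sz.
- rewrite -rcons_cons rcons_uniq up andbT; apply/negP => vp.
  by have := allP ap _ vp; rewrite En ltnn.
- rewrite -rcons_cons all_rcons En leqnn.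
  by apply: sub_all ap => w /leqW.
Qed.

Lemma level_bound par l v : leveled_forest par l -> l v < n.
Proof. by case/(level_path v) => x [p [pP _ <- up _]]; apply: short_paths up. Qed.

Definition raise_par (u v : V) (par : V -> V) w := if w == v then u else par w.
Definition raise_lvl (v : V) (par : V -> V) (l : V -> nat) w := l w + fconnect par w v.

(** Equal levels keep [u] out of the subtree of [v], so hanging [v] below [u] creates no cycle and
    lowers that subtree by exactly one level. *)
Lemma raise_forest par l u v : leveled_forest par l -> e u v -> l u = l v ->
  leveled_forest (raise_par u v par) (raise_lvl v par l).
Proof.
move=> F euv luv w; have neq_uv : u != v by apply: contraTneq euv => ->; rewrite e_irr.
rewrite /raise_par /raise_lvl; case: (eqVneq w v) => [-> | neq_wv].
  rewrite (negPf neq_uv) connect0; split=> //.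
  case cuv: (fconnect par u v); last by rewrite addn1 addn0 luv.
  by have := level_ancestor F cuv; rewrite luv ltnn (negPf neq_uv).
have := F w; case: eqP => [_ lw0|_ [ew lw]].
  case cwv: (fconnect par w v); rewrite lw0 //.
  by have := level_ancestor F cwv; rewrite lw0 (negPf neq_wv).
split=> //; rewrite lw addSn; congr (_ + _).+1.
congr nat_of_bool; apply/idP/idP; last exact/connect_trans/fconnect1.
case/connectP=> -[/= _ vE|z p /= /andP [/eqP <- pP] vE]; first by rewrite vE eqxx in neq_wv.
by apply/connectP; exists p.
Qed.

(* Among the spanning forests of [e], one that maximises the sum of the depths
   is properly coloured by depth: the subtree of the head of an arc inside a
   level could be hung below the tail of that arc. *)
Lemma gallai_roy : exists f : V -> nat,
  (forall v, f v < n) /\ forall u v, e u v -> f u <> f v.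
Proof.
(* Induction on the gap between the sum of the depths and its bound [n * #|V|], starting from the
   forest in which every vertex is a root. *)
suff IH m : forall par l, leveled_forest par l -> n * #|V| - \sum_v l v <= m ->
    exists f : V -> nat, (forall v, f v < n) /\ forall u v, e u v -> f u <> f v.
  by apply: (IH _ id (fun=> 0) _ (leqnn _)) => w; rewrite eqxx.
elim: m => [|m IHm] par l F le_m.
all: have [/existsP [u /existsP [v /andP [euv /eqP luv]]]|no_bad] :=
  boolP [exists u, exists v, e u v && (l u == l v)]; last first.
1,3: exists l; split=> [v|u v euv luv]; first exact: level_bound F.
1,2: by case/existsP: no_bad; exists u; apply/existsP; exists v; rewrite euv luv eqxx.
all: have F' := raise_forest F euv luv.
all: have gt_sum : \sum_w l w < \sum_w raise_lvl v par l w by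
  rewrite [X in _ < X]big_split /= -addn1 leq_add2l (bigD1 v) //= connect0.
all: have le_sum : \sum_w raise_lvl v par l w <= n * #|V| by
  rewrite mulnC -sum_nat_const; apply: leq_sum => w _; apply: ltnW (level_bound w F').
- lia.
- by apply: IHm F' _; lia.
Qed.

End GallaiRoy.

(** * Walks, and two ways to assemble a subdivision *)

Section Walks.
Variables (V : finType) (a : rel V).

Lemma walk_shorten x y p : x != y -> path a x (rcons p y) ->
  exists p', [/\ path a x (rcons p' y), uniq p', x \notin p', y \notin p' & {subset p' <= p}].
Proof.
move=> neq_xy pP; have lE := last_rcons x p y; case/shortenP: pP lE.
case/lastP => [|q y'] qP uq sub; first by move/eqP; rewrite (negPf neq_xy).
rewrite last_rcons => yE; rewrite {}yE in qP uq sub.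
move: uq; rewrite /= rcons_uniq mem_rcons inE negb_or => /and3P [/andP [_ xq] yq uq].
exists q; split=> // v vq; have := sub v; rewrite mem_rcons inE vq orbT mem_rcons inE.
by move/(_ isT)/predU1P => [vE|//]; rewrite -vE vq in yq.
Qed.

Lemma walk_last_exit (T : {pred V}) x y p : has [in T] (x :: p) ->
  path a x (rcons p y) ->
  exists z q, [/\ z \in x :: p, z \in T, path a z (rcons q y), {subset q <= p} &
                  all [predC T] q].
Proof.
elim: p x => [|z p IHp] x /=.
  by rewrite orbF => xT xP; exists x, [::]; rewrite inE eqxx.
move=> hasT /andP [axz pP]; case: (boolP (has [in T] (z :: p))) => hasTp.
  have [z0 [q [z0p z0T qP sub aq]]] := IHp z hasTp pP.
  by exists z0, q; split=> // [|v /sub vp]; rewrite inE ?z0p ?vp orbT.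
have xT : x \in T by move: hasT hasTp => /=; case: (x \in T) => //= ->.
exists x, (z :: p); split; rewrite ?inE ?eqxx //=; first by rewrite axz.
by have := hasTp; rewrite -all_predC.
Qed.

Lemma walk_first_hit (T : {pred V}) x y p : y \in T -> path a x (rcons p y) ->
  exists z q, [/\ z \in rcons p y, z \in T, path a x (rcons q z), {subset q <= p} &
                  all [predC T] q].
Proof.
move=> yT; elim: p x => [|z p IHp] x /=.
  by move=> xP; exists y, [::]; rewrite inE eqxx.
move=> /andP [axz pP]; case: (boolP (z \in T)) => zT.
  by exists z, [::]; rewrite inE eqxx /= andbT.
have [z0 [q [z0p z0T qP sub aq]]] := IHp z pP.
exists z0, (z :: q); rewrite inE z0p orbT /= axz qP zT aq; split=> // v.
by rewrite !inE => /predU1P [->|/sub ->]; rewrite ?eqxx ?orbT.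
Qed.

(** The lists [q1], [q2], [q3] are the interiors of the three paths. As [q1] is nonempty and
    disjoint from [q2], the two paths from [x] to [y] differ. *)
Lemma contains_B_intro k x y q1 q2 q3 :
  path a x (rcons q1 y) -> path a x (rcons q2 y) -> path a y (rcons q3 x) ->
  uniq [:: x, y & q1 ++ q2 ++ q3] -> q1 != [::] ->
  k <= (size q1).+1 -> k <= (size q3).+1 -> contains_B a k 1 k.
Proof.
have intE (q : seq V) z : interior (rcons q z) = q.
  by rewrite /interior size_rcons /= -cats1 take_size_cat.
move=> P1 P2 P3 /= /and3P []; rewrite inE negb_or !cat_uniq !mem_cat !negb_or.
move=> /and4P [nxy x1 x2 x3] /and3P [y1 y2 y3] /and5P [u1 + u2 d23 u3] q1n k1 k3.
rewrite has_cat negb_or => /andP [d12 d13].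
exists x, y, (rcons q1 y), (rcons q2 y), (rcons q3 x); split=> //.
- by rewrite /dipath P1 P2 P3 !last_rcons !eqxx /= !rcons_uniq !mem_rcons !inE
     !negb_or nxy x1 x2 x3 y1 y2 y3 u1 u2 u3 eq_sym nxy.
- by rewrite !size_rcons.
- rewrite eqseq_rcons eqxx andbT; apply/eqP => q12; rewrite -q12 in d12.
  by case: q1 q1n d12 {P1 x1 y1 u1 d13 k1 q12} => //= z q1 _; rewrite inE eqxx.
- by rewrite /int_disjoint !intE; split; rewrite all_predC has_sym.
Qed.

(** Once shortened, [r] closes the path into a cycle, and the part of [w] after its last vertex [u]
    on [z :: r] is an ear ending at [y]. Along the cycle, the way from [u] to [y] contains [p1] and
    the way back contains [p2], so both are long. *)
Lemma path_with_returns k x y z p1 p2 r w :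
  path a x (rcons p1 y) -> path a y (rcons p2 z) ->
  uniq (x :: p1 ++ y :: rcons p2 z) ->
  0 < k -> k <= (size p1).+1 -> k <= (size p2).+1 ->
  path a z (rcons r x) -> path a z (rcons w y) ->
  [disjoint r & x :: p1 ++ y :: rcons p2 z] ->
  [disjoint w & x :: p1 ++ y :: rcons p2 z] ->
  contains_B a k 1 k.
Proof.
set P := x :: _ => P1 P2 uP k0 k1 k2 + + dr dw.
have [xP yP zP] : [/\ x \in P, y \in P & z \in P].
  by rewrite !inE !mem_cat !inE !mem_rcons !inE !eqxx ?orbT.
have nzx : z != x.
  by apply: contraTneq uP => zx; rewrite /P zx /= mem_cat inE mem_rcons inE eqxx !orbT.
have nzy : z != y.
  apply: contraTneq uP => zy; rewrite /P zy -cat_cons cat_uniq /= mem_rcons inE eqxx.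
  by rewrite !andbF.
case/(walk_shorten nzx) => {}r' [rP ur zr xr subr].
case/(walk_shorten nzy) => {}w' [wP uw zw yw subw].
have {}dr : [disjoint r' & P] by apply: disjointWl dr; apply/subsetP.
have {}dw : [disjoint w' & P] by apply: disjointWl dw; apply/subsetP.
have hz : has [in z :: r'] (z :: w') by rewrite /= inE eqxx.
have [u [q [uzw uzr qP subq /allP dq]]] := walk_last_exit hz wP.
have nuy : u != y by apply: contraTneq uzw => ->; rewrite inE negb_or eq_sym nzy.
have [q' [q'P uq' _ _ subq']] := walk_shorten nuy qP.
have dq' : [disjoint q' & P].
  by apply: disjointWl dw; apply/subsetP => v /subq' /subq.
have dq'r : [disjoint q' & z :: r'].
  by rewrite disjoint_has -all_predC; apply/allP => v /subq' /dq.
have uall : uniq (P ++ r' ++ q').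
  rewrite !cat_uniq uP ur uq' has_cat negb_or -!disjoint_has dr dq' andbT /=.
  by move: dq'r; rewrite disjoint_sym disjoint_cons disjoint_sym andbT => /andP [_ ->].
(* If [u = z], all of [r'] lies on the way from [u] to [y]; otherwise [u] cuts [r'] in two and the
   first piece goes to the way back. *)
case/predU1P: uzr q'P => [-> q'P|].
  apply: (@contains_B_intro k z y (r' ++ x :: p1) q' p2) => //.
  - by rewrite rcons_cat /= -cat_rcons cat_path rP last_rcons.
  - rewrite (perm_uniq (_ : perm_eq _ (P ++ r' ++ q'))) //.
    apply/permP => f; rewrite /P -cats1 /= !count_cat /= !count_cat /=.
    clear -x y z p1 p2 r' q' f; lia.
  - by case: (r').
  - by rewrite size_cat /=; clear -k1; lia.
move=> ur'; case/splitPr: ur' rP uall => r1 r2 rP uall q'P.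
move: rP; rewrite rcons_cat cat_path /= => /and3P [r1P ar1u r2P].
apply: (@contains_B_intro k u y (r2 ++ x :: p1) q' (p2 ++ z :: r1)) => //.
- by rewrite rcons_cat /= -cat_rcons cat_path r2P last_rcons.
- by rewrite rcons_cat /= -cat_rcons cat_path P2 last_rcons rcons_path r1P.
- rewrite (perm_uniq (_ : perm_eq _ (P ++ (r1 ++ u :: r2) ++ q'))) //.
  apply/permP => f; rewrite /P -cats1 /= !count_cat /= !count_cat /=.
  clear -x y z u p1 p2 r1 r2 q' f; lia.
- by case: (r2).
- by rewrite size_cat /=; clear -k1; lia.
- by rewrite size_cat /=; clear -k2; lia.
Qed.
End Walks.

(** * Strongly connected sets and the distance to a set *)

Definition strong_in (V : finType) (a : rel V) (S : {set V}) : Prop :=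
  {in S &, forall x y, connect [rel u v | [&& u \in S, v \in S & a u v]] x y}.

Lemma dist_to_set (V : finType) (a : rel V) (S : {set V}) :
  (forall x, exists2 s, s \in S & connect a x s) ->
  exists b : V -> nat, [/\ forall x, (b x == 0) = (x \in S),
    forall u v, a u v -> b u <= (b v).+1 &
    forall x, x \notin S -> exists2 y, a x y & b x = (b y).+1].
Proof.
move=> reach; pose P x n := [exists t : n.-tuple V, path a x t && (last x t \in S)].
have exP x : exists n, P x n.
  have [s sS /connectP [p pP sE]] := reach x; exists (size p).
  by apply/existsP; exists (in_tuple p); rewrite pP -sE.
have arc u v n : a u v -> P v n -> P u n.+1.
  by move=> auv /existsP [t tP]; apply/existsP; exists (cons_tuple v t); rewrite /= auv.
pose b x := ex_minn (exP x); have bP x : P x (b x) by rewrite /b; case: ex_minnP.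
have b_min x n : P x n -> b x <= n by rewrite /b; case: ex_minnP => m _; apply.
exists b; split.
- move=> x; apply/eqP/idP => [b0|xS].
    by have /existsP [[[|//] st]] := bP x; rewrite ?b0 // in st *.
  apply/eqP; rewrite -leqn0; apply: b_min; apply/existsP; exists [tuple]; exact: xS.
- by move=> u v auv; apply: b_min; apply: arc auv _.
- move=> x xS; have /existsP [[t st]] := bP x.
  case: t st => [|y t] st /=; first by rewrite (negPf xS).
  move=> /andP [/andP [axy tP] lS]; exists y => //.
  apply/eqP; rewrite eqn_leq b_min ?(arc _ _ _ axy) //= -(eqP st) ltnS.
  by apply: b_min; apply/existsP; exists (in_tuple t); rewrite tP.
Qed.

Lemma seq_split_at (T : Type) (s : seq T) i : i < size s ->
  exists s1 x s2, s = s1 ++ x :: s2 /\ size s1 = i.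
Proof.
move=> lt_is; case E: (drop i s) (size_drop i s) => [|x s2] /=; first by lia.
by exists (take i s), x, s2; rewrite -E cat_take_drop size_takel // ltnW.
Qed.

(** * Petals of a strongly connected set, and their colouring *)

Section Petals.
Variables (V : finType) (a : rel V) (k : nat) (S : {set V}) (b : V -> nat).
Hypothesis k_gt1 : 1 < k.
Hypothesis bS : forall x, (b x == 0) = (x \in S).
Hypothesis b_arc : forall u v, a u v -> b u <= (b v).+1.
Hypothesis b_desc : forall x, x \notin S -> exists2 y, a x y & b x = (b y).+1.
Hypothesis S_strong : strong_in a S.
Hypothesis noB : ~ contains_B a k 1 k.

(** The arcs of shortest paths to [S]: [b] is injective on a [J]-path, whose length can be read off
    [b]. *)
Let J : rel V := [rel u v | a u v && (b u == (b v).+1)].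

Lemma J_path x p : path J x p -> path a x p.
Proof. by apply: sub_path => u v /andP []. Qed.

Lemma J_sorted x p : path J x p -> sorted (relpre b gtn) (x :: p).
Proof. by apply: sub_path => u v /andP [_ /eqP /= ->]. Qed.

Lemma J_decr x p : path J x p -> pairwise (relpre b gtn) (x :: p).
Proof.
by rewrite -sorted_pairwise; [apply: J_sorted | move=> u v w /= vu uw; apply: ltn_trans vu].
Qed.

Lemma J_uniq x p : path J x p -> uniq (x :: p).
Proof.
move/J_sorted; apply: sorted_uniq => [u v w /= vu uw|u /=]; last by rewrite ltnn.
exact: ltn_trans vu.
Qed.

Lemma J_below x p v : path J x p -> v \in p -> b v < b x.
Proof. by move/J_decr => /= /andP [/allP H _] /H. Qed.

Lemma J_inj x p : path J x p -> {in x :: p &, injective b}.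
Proof.
elim: p x => [|y p IHp] x; first by move=> _ u v; rewrite !inE => /eqP -> /eqP ->.
move=> xyp u v; have [_ /IHp inj] := andP xyp.
rewrite 2!inE => /predU1P [->|uyp] /predU1P [->|vyp] bE //; last exact: inj.
  by have := J_below xyp vyp; rewrite bE ltnn.
by have := J_below xyp uyp; rewrite bE ltnn.
Qed.

Lemma J_above w p v : path J w p -> v \in belast w p -> b (last w p) < b v.
Proof.
move/J_decr; rewrite lastI -cats1 pairwise_cat => /andP [/allrelP H _] vb.
by apply: (H v (last w p)) => //; rewrite inE.
Qed.

Lemma J_size x p : path J x p -> b x = b (last x p) + size p.
Proof.
elim: p x => [|y p IHp] x /=; first by rewrite addn0.
by case/andP => /andP [_ /eqP ->] /IHp ->; rewrite addnS.
Qed.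

Lemma J_reach x : exists2 p, path J x p & last x p \in S.
Proof.
move En: (b x) => n; elim: n x En => [|n IHn] x En.
  by exists [::]; rewrite //= -bS En.
have xS : x \notin S by rewrite -bS En.
have [y axy] := b_desc xS; rewrite En => -[yn].
have [p pP lS] := IHn y (esym yn).
by exists (y :: p); rewrite //= pP /J /= axy En yn eqxx.
Qed.

Lemma S_walk s s' : s \in S -> s' \in S ->
  exists p, [/\ path a s p, last s p = s', uniq (s :: p) & {subset p <= S}].
Proof.
move=> sS s'S; have /connectP [p pP ->] := S_strong sS s'S.
case/shortenP: pP => q qP uq _; exists q; split=> //.
  by apply: sub_path qP => u v /and3P [].
elim: q s {sS uq} qP => //= y q IHq s /andP [/and3P [_ yS _] qP] v.
by rewrite inE => /predU1P [-> //|]; apply: IHq qP _.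
Qed.

Definition petals : {set V} :=
  [set x | (x \notin S) && [exists s in S, exists w, a s w && connect J w x]].

Lemma petalsP x : reflect (x \notin S /\ exists s w, [/\ s \in S, a s w & connect J w x])
                          (x \in petals).
Proof.
rewrite inE; apply: (iffP andP) => [[xS /exists_inP [s sS /existsP [w /andP [asw wx]]]]|].
  by split=> //; exists s, w.
move=> [xS [s [w [sS asw wx]]]]; split=> //; apply/exists_inP; exists s => //.
by apply/existsP; exists w; rewrite asw.
Qed.

Definition kappa n := if n < k then n else k + n %% k.

Lemma kappa_lt n : kappa n < 2 * k.
Proof.
rewrite /kappa; have := ltn_pmod n (ltnW k_gt1); move: (n %% k) => m mk; case: (ltnP n k); lia.
Qed.

(** Values below [k] have a colour of their own; the others share a colour only if they differ by a
    multiple of [k]. *)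
Lemma kappa_gap m n : kappa m = kappa n -> m < n -> k <= m /\ m + k <= n.
Proof.
rewrite /kappa; case: (ltnP m k) => mk; case: (ltnP n k) => nk //; try lia.
move/addnI => E lt_mn; split=> //; rewrite (divn_eq m k) (divn_eq n k) E.
have : m %/ k < n %/ k.
  rewrite ltnNge; apply/negP => le_nm; move: lt_mn.
  rewrite (divn_eq m k) (divn_eq n k) E ltn_add2r ltn_mul2r; lia.
by move=> lt; rewrite addnAC leq_add2r -mulSnr leq_mul2r lt orbT.
Qed.

(** A drop inside a class would be at least [k], hence more than one. *)
Lemma kappa_arc m n : kappa m = kappa n -> m <= n.+1 -> m <= n.
Proof.
move=> E le_mn; rewrite leqNgt; apply/negP => lt_nm.
by have [] := kappa_gap (esym E) lt_nm; lia.
Qed.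

Definition slice c : {set V} := [set x in petals | kappa (b x) == c].

Lemma slice_out c x : x \in slice c -> x \notin S.
Proof. by rewrite inE => /andP [/petalsP []]. Qed.

Lemma slice_mono c P : sorted a P -> {subset P <= slice c} ->
  pairwise (relpre b leq) P.
Proof.
move=> sP /allP aP; rewrite -sorted_pairwise => [|u v w /= vu uw]; last exact: leq_trans vu uw.
apply: (sub_in_sorted _ aP sP) => u v; rewrite !inE => /andP [_ /eqP ku] /andP [_ /eqP kv] auv.
by apply: kappa_arc; [rewrite ku kv | apply: b_arc].
Qed.

(** If a nontrivial [J]-path led from [u] to [v], the part of [P] from [v] to [u] would first meet
    the petal through [u] and [v] at some [x] with [b x > b v]. This ear from [v] to [x], the way
    from [v] to [x] around the petal through [S], and the [J]-path from [x] back to [v] form the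
    subdivision. *)
Lemma slice_J_free c P : sorted a P -> uniq P -> {subset P <= slice c} ->
  {in P &, forall u v, connect J u v -> u = v}.
Proof.
move=> sP uP subP u v uP' vP Juv; apply/eqP; apply: contraT => neq_uv; case: noB.
have [p2 p2P vE] := connectP Juv.
have lt_vu : b v < b u.
  apply: (J_below p2P); have := mem_last u p2.
  by rewrite -vE inE eq_sym (negPf neq_uv).
(* As [b] never decreases along [P], [v] comes before [u]; [q] is the stretch between them. *)
have [q [qP qsub vq b_le]] :
    exists q, [/\ path a v (rcons q u), {subset rcons q u <= slice c}, v \notin rcons q u &
      {in rcons q u, forall x, b v <= b x}].
  have mono := slice_mono sP subP.
  case/splitPr: vP uP' subP sP uP mono => P1 P2.
  rewrite mem_cat inE (negPf neq_uv) /= => /orP [uP1|].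
    rewrite pairwise_cat => _ _ _ /andP [/allrelP /(_ u v uP1)].
    by rewrite inE eqxx /= => /(_ isT); rewrite leqNgt lt_vu.
  case/splitPr => q P3; rewrite -(cat_rcons u) => subP + + mono.
  rewrite cat_uniq sorted_cat_cons => /andP [_ + /and3P [_ _] /= /andP [vq _]].
  rewrite cat_path => /andP [qP _]; exists q; split=> //.
  - by move=> w wq; apply: subP; rewrite mem_cat inE mem_cat wq !orbT.
  - by apply: contraNN vq; rewrite mem_cat => ->.
  - move=> w wq; move: mono; rewrite pairwise_cat => /and3P [_ _ /= /andP [/allP H _]].
    by apply: H; rewrite mem_cat wq.
have u_slice := subP u uP'; have v_slice := subP v vP.
have /petalsP [_ [s [w [sS asw /connectP [p1 p1P uE]]]]] : u \in petals.
  by move: u_slice; rewrite inE => /andP [].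
have [p3 p3P s'S] := J_reach v; set s' := last v p3 in s'S.
pose L := w :: (p1 ++ p2) ++ p3.
have p12P : path J w (p1 ++ p2) by rewrite cat_path p1P -uE.
have p12E : last w (p1 ++ p2) = v by rewrite last_cat -uE.
have LP : path J w ((p1 ++ p2) ++ p3) by rewrite cat_path p12P p12E.
have uL : u \in L.
  by rewrite /L -cat_cons mem_cat -cat_cons mem_cat uE mem_last.
have [x [q1 [xq xL q1P subq1 /allP dq1]]] := walk_first_hit uL qP.
have neq_xv : x != v by apply: contraNneq vq => <-.
have neq_vx : v != x by rewrite eq_sym.
have [q' [q'P uq' _ _ subq']] := walk_shorten neq_vx q1P.
have x_slice := qsub x xq.
have vL : v \in w :: p1 ++ p2 by rewrite -p12E mem_last.
have lt_vx : b v < b x.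
  rewrite ltn_neqAle b_le // andbT; apply: contra neq_xv => /eqP bE.
  by apply/eqP; apply: (J_inj LP) => //; rewrite -cat_cons mem_cat vL.
(* One bound for each long path: [b v] arcs lead from [v] down to [S], and [b x - b v] arcs from [x]
   down to [v]. *)
have [k_le_bv gap] : k <= b v /\ b v + k <= b x.
  apply: kappa_gap lt_vx; move: v_slice x_slice.
  by rewrite !inE => /andP [_ /eqP ->] /andP [_ /eqP ->].
have [L1 [L2 LE]] : exists L1 L2, w :: p1 ++ p2 = L1 ++ x :: rcons L2 v.
  have xb : x \in belast w (p1 ++ p2).
    have : x \in w :: p1 ++ p2.
      move: xL; rewrite /L -cat_cons mem_cat => /orP [//|/(J_below p3P)].
      by rewrite ltnNge (ltnW lt_vx).
    by rewrite lastI p12E mem_rcons inE (negPf neq_xv).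
  rewrite lastI p12E; case/splitPr: xb => L1 L2; exists L1, L2.
  by rewrite rcons_cat.
have xvP : path J x (rcons L2 v).
  have : sorted J (w :: p1 ++ p2) by [].
  by rewrite LE sorted_cat_cons => /andP [].
have swP : path a s (rcons L1 x).
  have : path a s (w :: p1 ++ p2) by rewrite /= asw J_path.
  by rewrite LE -cat_rcons cat_path => /andP [].
have [sg [sgP sgE usg sgS]] := S_walk s'S sS.
have s'0 : b s' = 0 by apply/eqP; rewrite bS.
have size3 : b v = size p3 by rewrite (J_size p3P) -/s' s'0.
have sizeL2 : b x = b v + (size L2).+1 by rewrite (J_size xvP) last_rcons size_rcons.
apply: (@contains_B_intro _ a k v x (p3 ++ sg ++ L1) q' L2) => //.
- by rewrite !rcons_cat cat_path J_path // cat_path sgP sgE.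
- exact: J_path xvP.
- rewrite (perm_uniq (_ : perm_eq _ (L ++ sg ++ q'))); last first.
    rewrite /L -(cat_cons w) LE; apply/permP => f.
    rewrite -cats1 /= !count_cat /= !count_cat /=.
    by clear -x v L1 L2 p3 sg q' f; lia.
  have q'S y : y \in q' -> y \notin S.
    move=> /subq' /subq1 yq; apply: slice_out (qsub y _).
    by rewrite mem_rcons inE yq orbT.
  move: usg; rewrite cons_uniq => /andP [s'sg usg].
  rewrite !cat_uniq (J_uniq LP) has_cat negb_or -!all_predC usg uq' andbT /=.
  rewrite -andbA.
  apply/and3P; split; apply/allP => y /=.
  (* The only vertex of [L] in [S] is [s'], to which [sg] does not return. *)
  - move=> ysg; apply/negP => yL; have y0 : b y = 0 by apply/eqP; rewrite bS sgS.
    have s'L : s' \in L by rewrite /s' -p12E -last_cat mem_last.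
    by case/negP: s'sg; rewrite -(J_inj LP yL s'L) // s'0.
  - by move=> /subq' /dq1.
  - by move=> yq; apply: contraNN (q'S y yq) => /sgS.
- by case: (p3) size3 => //= bv0; clear -k_gt1 k_le_bv bv0; lia.
- by rewrite size_cat -size3; clear -k_le_bv; lia.
- by rewrite -(leq_add2l (b v)) -sizeL2.
Qed.

(** Descend from [z] to [S], cross [S], and come out along a petal to [x]. If [z] and [x] lie on a
    path inside a slice, the walk avoids that path: slices miss [S], and [slice_J_free] excludes the
    other two alternatives. *)
Lemma return_walk z x : x \in petals -> exists2 r, path a z (rcons r x) &
  {in r, forall v, [|| v \in S, (v != z) && connect J z v | (v != x) && connect J v x]}.
Proof.
move=> /petalsP [_ [s [w [sS asw /connectP [p3 p3P xE]]]]].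
have [p1 p1P s'S] := J_reach z; have [sg [sgP sgE _ sgS]] := S_walk s'S sS.
exists (p1 ++ sg ++ belast w p3).
  by rewrite !rcons_cat xE -lastI !cat_path J_path // sgP sgE /= asw J_path.
move=> v; rewrite !mem_cat => /or3P [vp1|/sgS -> //|vp3]; apply/or3P.
- apply: Or32; apply/andP; split.
    by apply: contraTneq (J_below p1P vp1) => ->; rewrite ltnn.
  case/splitPr: vp1 p1P => q1 q2; rewrite -cat_rcons cat_path => /andP [qP _].
  by apply/connectP; exists (rcons q1 v); rewrite // last_rcons.
- apply: Or33; apply/andP; split.
    by apply: contraTneq (J_above p3P vp3) => ->; rewrite xE ltnn.
  case/splitPl: (mem_belast vp3) p3P xE => q1 q2 qE.
  rewrite cat_path last_cat qE => /andP [_ qP] xE.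
  by apply/connectP; exists q2.
Qed.

Lemma slice_short c P : sorted a P -> uniq P -> {subset P <= slice c} -> size P < (2 * k).+1.
Proof.
move=> sP uP subP; rewrite ltnNge; apply/negP => big; case: noB.
have free := slice_J_free sP uP subP.
case: P => [//|x Q] in sP uP subP big free *.
(* The vertices [x], [y], [z] are taken at positions 0, [k] and [2 * k] of the path. *)
have [|p1 [y [Q1 [QE sz1]]]] := @seq_split_at V Q k.-1; first by move: big => /=; clear -k_gt1; lia.
have [|p2 [z [Q2 [QE1 sz2]]]] := @seq_split_at V Q1 k.-1.
  by move: big; rewrite QE /= size_cat sz1 /=; clear -k_gt1; lia.
have E : x :: Q = (x :: p1 ++ y :: rcons p2 z) ++ Q2.
  by rewrite QE QE1 /= -catA /= cat_rcons.
set P := (x :: p1 ++ _) in E; rewrite {}E in sP uP subP free.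
have sub1 : {subset P <= P ++ Q2} by move=> v; rewrite mem_cat => ->.
have uP1 : uniq P by move: uP; rewrite cat_uniq => /andP [].
have P1P : path a x (rcons p1 y) /\ path a y (rcons p2 z).
  move: sP; rewrite /= cat_path -cat_rcons cat_path last_rcons.
  by move=> /andP [/andP []].
have k_le : k <= (k.-1).+1 by clear -k_gt1; lia.
have [xP yP zP] : [/\ x \in P, y \in P & z \in P].
  by rewrite !inE !mem_cat !inE !mem_rcons !inE !eqxx ?orbT.
have ret v : v \in P -> exists2 r, path a z (rcons r v) & [disjoint r & P].
  move=> vP; have /return_walk : v \in petals.
    by have := subP v (sub1 v vP); rewrite inE => /andP [].
  move=> /(_ z) [r rP rfree]; exists r => //.
  rewrite disjoint_has -all_predC; apply/allP => u ur; apply/negP => /= uP2.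
  case/or3P: (rfree u ur) => [|/andP [/eqP + zu]|/andP [/eqP + uv]].
  - by apply/negP; apply: slice_out (subP _ (sub1 _ uP2)).
  - by case; apply/esym/free => //; apply: sub1.
  - by case; apply: free => //; apply: sub1.
have [r rP dr] := ret x xP; have [w wP dw] := ret y yP.
by apply: (path_with_returns P1P.1 P1P.2 uP1 _ _ _ rP wP dr dw); rewrite ?sz1 ?sz2 // ltnW.
Qed.

Lemma petals_coloring : irreflexive a -> exists g : V -> nat,
  (forall v, g v < 2 * k * (2 * k)) /\
  {in petals &, forall u v, a u v -> g u <> g v}.
Proof.
move=> a_irr.
pose e := [rel u v | [&& u \in petals, v \in petals, kappa (b u) == kappa (b v) & a u v]].
have e_irr : irreflexive e by move=> u; rewrite /= a_irr !andbF.
have k2_gt0 : 0 < 2 * k by clear -k_gt1; lia.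
(* [slice_short] counts vertices and [gallai_roy] counts arcs, whence the shift by one. *)
have eP x p : path e x p -> uniq (x :: p) -> size p < 2 * k.
  case: p => [//|y p] xP uP; have := @slice_short (kappa (b x)) [:: x, y & p] _ uP.
  apply => [|v]; first by apply: sub_path xP => u v /and4P [].
  have xPt : x \in petals by move: xP => /= /andP [/and4P []].
  have : all [in slice (kappa (b x))] (y :: p).
    elim: (y :: p) x xPt xP {uP} => //= z q IHq x xPt /andP [/and4P [_ zPt /eqP kz _] qP].
    by rewrite inE zPt -kz eqxx kz IHq.
  by move/allP => sub; rewrite inE => /predU1P [->|/sub //]; rewrite inE xPt eqxx.
have [f [f_lt f_proper]] := gallai_roy e_irr eP.
(* The pair of the distance class and the Gallai-Roy colour, written in base [2 * k]. *)
exists (fun v => kappa (b v) * (2 * k) + f v); split=> [v|u v uP vP auv E].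
  apply: (@leq_trans ((kappa (b v)).+1 * (2 * k))); last by rewrite leq_mul2r kappa_lt orbT.
  by rewrite mulSn addnC ltn_add2r.
have kE : kappa (b u) = kappa (b v).
  have := congr1 (divn^~ (2 * k)) E.
  by rewrite /= !divnMDl // !divn_small // !addn0.
apply: (f_proper u v); first by rewrite /= uP vP kE eqxx.
by move: E; rewrite kE => /addnI.
Qed.

(** All connections pass through [s0]: a [J]-path leads down to [S], and a petal leads back up. *)
Lemma petals_strong s0 : s0 \in S -> strong_in a (S :|: petals).
Proof.
move=> s0S; set R := [rel u v | [&& u \in S :|: petals, v \in S :|: petals & a u v]].
have J_closed x v : x \in petals -> connect J x v -> v \in S :|: petals.
  move=> /petalsP [_ [s [w [sS asw wx]]]] xv; rewrite inE; case: (boolP (v \in S)) => //= vS.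
  by apply/petalsP; split=> //; exists s, w; split=> //; apply: connect_trans xv.
have JR x p : x \in petals -> path J x p -> path R x p.
  move=> xP pP; have : all [in S :|: petals] (x :: p).
    apply/allP => v vp; case/splitPl: vp pP => q1 q2 qE; rewrite cat_path => /andP [q1P _].
    by apply: (J_closed x) => //; apply/connectP; exists q1.
  move=> al; apply: (sub_in_path _ al pP) => u v uS vS /andP [auv _].
  by rewrite /= uS vS.
have SR : {in S &, forall s s', connect R s s'}.
  move=> s s' sS s'S; apply: connect_sub (S_strong sS s'S) => u v /and3P [uS vS auv].
  by apply: connect1; rewrite /= !inE uS vS.
have down x : x \in S :|: petals -> connect R x s0.
  rewrite inE => /orP [xS|xP]; first exact: SR.
  have [p pP pS] := J_reach x; apply: connect_trans (SR _ _ pS s0S).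
  by apply/connectP; exists p; rewrite // JR.
have up x : x \in S :|: petals -> connect R s0 x.
  rewrite inE => /orP [xS|xP]; first exact: SR.
  have /petalsP [xS [s [w [sS asw /connectP [p pP xE]]]]] := xP.
  have wP : w \in petals.
    apply/petalsP; split; last by exists s, w.
    rewrite -bS -lt0n; apply: leq_trans (_ : b x <= b w); first by rewrite lt0n bS.
    by rewrite (J_size pP) -xE leq_addr.
  apply: connect_trans (SR _ _ s0S sS) _; apply: (@connect_trans _ _ w).
    by apply: connect1; rewrite /= !in_setU sS wP orbT.
  by apply/connectP; exists p; rewrite // JR.
by move=> x y xP yP; apply: connect_trans (down x xP) (up y yP).
Qed.

End Petals.

(** * Reversing arcs, and layers around a strongly connected set *)

Lemma contains_B_rev (V : finType) (a : rel V) k1 k2 k3 :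
  contains_B (fun x y => a y x) k1 k2 k3 -> contains_B a k1 k2 k3.
Proof.
(* Read backwards, [x :: p] starts at its last vertex and goes on with [rv x p]; the two branch
   vertices trade places. *)
pose rv (x : V) p := rev (belast x p).
have rvP x y p : x != y -> dipath (fun x y => a y x) x y p ->
    [/\ dipath a y x (rv x p), size (rv x p) = size p & interior (rv x p) = rev (interior p)].
  case/lastP: p => [|p y'] nxy; first by rewrite /dipath /= (negPf nxy).
  move=> /and3P [pP /eqP]; rewrite last_rcons => yE; rewrite {}yE {y'} in pP *.
  rewrite /rv belast_rcons rev_cons /interior !size_rcons size_rev /= => uq.
  rewrite -!cats1 !take_size_cat ?size_rev //; split=> //.
  have E : y :: rcons (rev p) x = rev (x :: rcons p y) by rewrite rev_cons rev_rcons.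
  rewrite /dipath cats1 last_rcons eqxx andTb E rev_uniq (uq : uniq (x :: _)) andbT -rev_cons.
  by have := rev_path a x (rcons p y); rewrite last_rcons belast_rcons => ->.
have int_rev p q p' q' : interior p' = rev (interior p) -> interior q' = rev (interior q) ->
    int_disjoint p q -> int_disjoint p' q'.
  rewrite /int_disjoint => -> ->; rewrite all_rev => /allP d.
  by apply/allP => v /d; rewrite mem_rev.
move=> [x [y [p1 [p2 [p3 [nxy [P1 P2 P3] [s1 s2 s3] p12 [d12 d13 d23]]]]]]].
have nyx : y != x by rewrite eq_sym.
have [Q1 t1 i1] := rvP _ _ _ nxy P1; have [Q2 t2 i2] := rvP _ _ _ nxy P2.
have [Q3 t3 i3] := rvP _ _ _ nyx P3.
exists y, x, (rv x p1), (rv x p2), (rv y p3); split=> //.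
- by rewrite t1 t2 t3.
- apply: contra p12 => /eqP /(congr1 rev); rewrite !revK => bE.
  have [/and3P [_ /eqP l1 _] /and3P [_ /eqP l2 _]] := conj P1 P2.
  have : x :: p1 = x :: p2 by rewrite !lastI bE l1 l2.
  by case=> ->.
- by split; [apply: int_rev d12 | apply: int_rev d13 | apply: int_rev d23].
Qed.

Lemma contains_B_mono (V : finType) (a : rel V) k k' :
  k <= k' -> contains_B a k' 1 k' -> contains_B a k 1 k.
Proof.
move=> le_k [x [y [p1 [p2 [p3 [? ? [s1 s2 s3] ? ?]]]]]].
by exists x, y, p1, p2, p3; split=> //; split=> //; apply: leq_trans le_k _.
Qed.

Lemma strong_inU (V : finType) (a : rel V) (A B : {set V}) s :
  s \in A -> s \in B -> strong_in a A -> strong_in a B -> strong_in a (A :|: B).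
Proof.
move=> sA sB strA strB.
have lift (C : {set V}) x y : C \subset A :|: B -> strong_in a C -> x \in C -> y \in C ->
    connect [rel u v | [&& u \in A :|: B, v \in A :|: B & a u v]] x y.
  move=> /subsetP sub strC xC yC; apply: connect_sub (strC x y xC yC) => u v /and3P [uC vC auv].
  by apply: connect1; rewrite /= !sub.
have lA := lift A _ _ (subsetUl _ _) strA; have lB := lift B _ _ (subsetUr _ _) strB.
move=> x y; rewrite !inE => /orP [xA|xB] /orP [yA|yB]; first exact: lA.
- by apply: connect_trans (lA _ _ xA sA) (lB _ _ sB yB).
- by apply: connect_trans (lB _ _ xB sB) (lA _ _ sA yA).
- exact: lB.
Qed.

(** Each arc leaving [S] starts a petal, so the petals contain all out-neighbours outside [S]. *)
Lemma out_layer (V : finType) (a : rel V) k (S : {set V}) s0 :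
  1 < k -> irreflexive a -> strongly_connected a -> ~ contains_B a k 1 k ->
  s0 \in S -> strong_in a S ->
  exists (X : {set V}) (g : V -> nat),
    [/\ forall s w, s \in S -> a s w -> w \in S :|: X,
        strong_in a (S :|: X), forall v, g v < 2 * k * (2 * k) &
        {in X &, forall u v, a u v -> g u <> g v}].
Proof.
move=> k_gt1 a_irr a_str noB s0S S_str.
have [|b [bS b_arc b_desc]] := @dist_to_set V a S; first by move=> x; exists s0 => //; apply: a_str.
have [g [g_lt g_proper]] := petals_coloring k_gt1 bS b_arc b_desc S_str noB a_irr.
exists (petals a S b), g; split=> //; last exact: (petals_strong bS b_desc S_str s0S).
move=> s w sS asw; rewrite in_setU; case: (boolP (w \in S)) => //= wS.
by apply/petalsP; split=> //; exists s, w.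
Qed.

Lemma strong_in_rev (V : finType) (a : rel V) S :
  strong_in (fun x y => a y x) S -> strong_in a S.
Proof.
move=> str x y xS yS.
have /= <- := connect_rev [rel u v | [&& u \in S, v \in S & a u v]] y x.
apply: connect_sub (str y x yS xS) => u v /and3P [uS vS avu].
by apply: connect1; rewrite /= uS vS.
Qed.

Lemma layer (V : finType) (a : rel V) k (S : {set V}) s0 :
  1 < k -> irreflexive a -> strongly_connected a -> ~ contains_B a k 1 k ->
  s0 \in S -> strong_in a S ->
  exists (X : {set V}) (g : V -> nat),
    [/\ forall s w, s \in S -> a s w || a w s -> w \in S :|: X,
        strong_in a (S :|: X), forall v, g v < 8 * k ^ 2 &
        {in X &, forall u v, a u v -> g u <> g v}].
Proof.
move=> k_gt1 a_irr a_str noB s0S S_str.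
have [X [g [Xout X_str g_lt g_proper]]] := out_layer k_gt1 a_irr a_str noB s0S S_str.
have [||||Y [h [Yout Y_str h_lt h_proper]]] := @out_layer V (fun x y => a y x) k S s0 k_gt1 _ _ _ s0S.
- by move=> x; apply: a_irr.
- by move=> x y; have /= -> := connect_rev a x y.
- by move/contains_B_rev.
- exact: strong_in_rev.
(* The two families of petals get disjoint palettes of [4 * k ^ 2] colours; a vertex in both is
   coloured as in [X]. *)
exists (X :|: Y), (fun v => if v \in X then g v else 2 * k * (2 * k) + h v); split.
- move=> s w sS /orP [/(Xout _ _ sS)|/(Yout _ _ sS)]; rewrite !inE => /orP [] ->; rewrite ?orbT //.
- rewrite (_ : S :|: (X :|: Y) = (S :|: X) :|: (S :|: Y)); last first.
    by rewrite setUACA setUid.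
  by apply: (@strong_inU _ _ _ _ s0); rewrite ?inE ?s0S //; apply: strong_in_rev.
- move=> v; have := g_lt v; have := h_lt v; case: ifP => _; lia.
- move=> u v; rewrite !inE; case: ifP => uX; case: ifP => vX //= uY vY auv.
  + exact: g_proper.
  + by move=> E; have := g_lt u; rewrite E; lia.
  + by move=> E; have := g_lt v; rewrite -E; lia.
  + by move/addnI; apply: nesym; apply: h_proper.
Qed.

(** Here [h] is the parity of the layer and [f] the colour inside it. *)
Lemma B_free_coloring (V : finType) (a : rel V) k (s0 : V) :
  1 < k -> irreflexive a -> strongly_connected a -> ~ contains_B a k 1 k ->
  exists (h : V -> bool) (f : V -> nat), (forall v, f v < 8 * k ^ 2) /\
    forall u v, a u v -> (h u, f u) <> (h v, f v).
Proof.
move=> k_gt1 a_irr a_str noB.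
(* [beta] is the parity of the last layer added. Only that layer can have neighbours outside [S],
   since each step absorbs all neighbours of the previous set. *)
have grow n : forall (S : {set V}) (h : V -> bool) (f : V -> nat) beta,
    #|~: S| <= n -> s0 \in S -> strong_in a S ->
    (forall u w, u \in S -> w \notin S -> a u w || a w u -> h u = beta) ->
    (forall v, f v < 8 * k ^ 2) ->
    {in S &, forall u v, a u v -> (h u, f u) <> (h v, f v)} ->
    exists (h : V -> bool) (f : V -> nat), (forall v, f v < 8 * k ^ 2) /\
      forall u v, a u v -> (h u, f u) <> (h v, f v).
  elim: n => [|n IHn] S h f beta le_n s0S S_str bdry f_lt proper.
    have inS v : v \in S.
      move: le_n; rewrite leqn0 => /eqP /card0_eq /(_ v).
      by rewrite inE => /negbFE.
    by exists h, f; split=> // u v; apply: proper.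
  have [X [g [nbr str g_lt g_proper]]] := layer k_gt1 a_irr a_str noB s0S S_str.
  (* If the layer adds nothing, no arc leaves [S], and strong connectivity makes [S] the whole
     vertex set. *)
  have [XS|/subsetPn [x xX xS]] := boolP (X \subset S).
    have inS w : w \in S.
      have /connectP [p pP ->] := a_str s0 w; move: (s0) s0S pP.
      elim: p => //= y p IHp x xS /andP [axy]; apply: IHp.
      by have := nbr x y xS; rewrite axy (setUidPl XS); apply.
    by exists h, f; split=> // u v; apply: proper.
  have inX u : u \in S :|: X -> u \notin S -> u \in X.
    by rewrite inE => /orP [->|].
  apply: (IHn (S :|: X) (fun v => if v \in S then h v else ~~ beta)
           (fun v => if v \in S then f v else g v) (~~ beta)) => //.
  - rewrite -ltnS; apply: leq_trans le_n; apply: proper_card; apply/properP; split.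
      by rewrite setCS subsetUl.
    by exists x; rewrite !inE ?xX ?orbT.
  - by rewrite inE s0S.
  - move=> u w _ wSX auw; case: ifP => // uS.
    by rewrite (nbr u w uS auw) in wSX.
  - by move=> v; case: ifP.
  - move=> u v uSX vSX auv.
    case: ifP => uS; case: ifP => vS; first exact: proper.
    + by case; rewrite (bdry u v) ?vS ?auv //; case: beta {bdry}.
    + by case; rewrite (bdry v u) ?uS ?auv ?orbT //; case: beta {bdry}.
    + by case; apply: g_proper; rewrite // inX ?uS ?vS.
apply: (grow _ [set s0] (fun=> true) (fun=> 0) true (leqnn _)) => //.
- by rewrite inE.
- by move=> x y /set1P -> /set1P ->; apply: connect0.
- by move=> _; rewrite muln_gt0 expn_gt0 (ltnW k_gt1).
- by move=> u v /set1P -> /set1P ->; rewrite a_irr.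
Qed.

(** * From colourings to the chromatic number *)

Lemma chi_le (V : finType) (a : rel V) c : colorable a c -> chi a <= c.
Proof.
move=> col; rewrite /chi; case: (leqP c #|V|) => [le_cV|lt_Vc].
  rewrite leqNgt; apply/negP => /(before_find 0).
  by rewrite nth_iota ?ltnS // add0n col.
(* When [c > #|V|], the length [#|V|.+1] of the searched list already bounds [chi]. *)
by apply: leq_trans (find_size _ _) _; rewrite size_iota.
Qed.

Lemma colorable_of_nat (V : finType) (a : rel V) c (f : V -> nat) :
  (forall v, f v < c) -> (forall u v, a u v -> f u <> f v) -> colorable a c.
Proof.
move=> f_lt f_proper; apply/existsP; exists [ffun v => Ordinal (f_lt v)].
apply/forallP => u; apply/forallP => v; apply/implyP => auv; apply/eqP.
rewrite !ffunE => /(congr1 val) /= fE.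
by case/orP: auv => /f_proper; rewrite fE.
Qed.

Theorem mainTheorem4 :
  forall k : nat, 0 < k ->
  exists gamma : nat,
    forall (V : finType) (a : rel V),
      loopless a -> strongly_connected a -> gamma < chi a ->
      contains_B a k 1 k.
Proof.
(* Petals require [1 < K], so [k] is replaced by [k.+1]; a subdivision for [K] is also one for [k].
   The factor 2 counts the parities of layers. *)
move=> k k_gt0; pose K := k.+1; pose c := 8 * K ^ 2; exists (2 * c) => V a a_irr a_str lt_chi.
apply: NNPP => noB; move: lt_chi; apply/negP; rewrite -leqNgt; apply: chi_le.
(* The growth of layers needs a starting vertex; the empty digraph is coloured vacuously. *)
have [/existsP [s0 _]|no_vertex] := boolP [exists v : V, true]; last first.
  have V0 (v : V) : False by case/existsP: no_vertex; exists v.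
  by apply: (@colorable_of_nat _ _ _ (fun=> 0)) => v; case: (V0 v).
have [|h [f [f_lt proper]]] := @B_free_coloring V a K s0 k_gt0 a_irr a_str.
  by move/(contains_B_mono (leqnSn k)).
apply: (@colorable_of_nat _ _ _ (fun v => h v * c + f v)) => [v|u v auv E].
  have : f v < c by apply: f_lt.
  by case: (h v); lia.
have c_gt0 : 0 < c by rewrite muln_gt0 expn_gt0.
have hE : (h u : nat) = h v.
  have := congr1 (divn^~ c) E.
  by rewrite /= !divnMDl // !divn_small ?addn0 //; apply: f_lt.
apply: (proper u v auv); congr (_, _); last by move: E; rewrite hE => /addnI.
by case: (h u) (h v) hE => [] [].
Qed.
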